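(* Let $d\ge 1$. For each integer $q$ with $d\le q\le 2d-1$ and for any $\mu=(\mu_0,\ldots,\mu_{2d-1})\in\mathbb{R}^{2d}$ the variety $S_q(\mu)$ satisfies the following conditions: 1. Either $S_q(\mu)$ is empty, or it is smooth and its dimension is greater than or equal to $2d-q-1$. 2. $S^x_q(\mu)$ is defined in $\mathcal{P}^x_d$ by the system $$\sum_{i=0}^d\mu_{l-i}\,\sigma_i(x_1,\ldots,x_d)=0,\qquad l=d,\ldots,q,$$ considered as a non-linear system in $x_1,\ldots,x_d$. The Vieta mapping $VM_d$ and its inverse, the root mapping $RM_d$, provide a diffeomorphism between $S^x_q(\mu)$ and $L^h_q(\mu)$. 3. The projection $p_x:S_q(\mu)\to S^x_q(\mu)$, as well as its inverse, are one-to-one, and provide a diffeomorphism between $S_q(\mu)$ and $S^x_q(\mu)$.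
   Context: Let $\mathcal{P}^x_d=\{(x_1,\ldots,x_d)\in\mathbb{R}^d : x_1<x_2<\cdots<x_d\}$ (the space of nodes), $\mathcal{P}^a_d=\mathbb{R}^d$ (the space of amplitudes $a=(a_1,\ldots,a_d)$), and $\mathcal{P}_d=\mathcal{P}^a_d\times\mathcal{P}^x_d$. For $\mu\in\mathbb{R}^{2d}$ and $0\le q\le 2d-1$, the Prony variety is $$S_q(\mu)=\Big\{(a,x)\in\mathcal{P}_d : \sum_{j=1}^d a_jx_j^k=\mu_k,\ k=0,1,\ldots,q\Big\},$$ and $S^x_q(\mu)=p_x(S_q(\mu))\subset\mathcal{P}^x_d$, where $p_x(a,x)=x$. The (signed) Vieta polynomials are $\sigma_0=1$ and $\sigma_k(x_1,\ldots,x_d)=(-1)^k\sum_{1\le i_1<\cdots<i_k\le d}x_{i_1}\cdots x_{i_k}$ for $1\le k\le d$, so that $\prod_{j=1}^d(z-x_j)=z^d+\sigma_1z^{d-1}+\cdots+\sigma_d$. Let $\mathcal{V}_d\cong\mathbb{R}^d$ be the space of coefficient vectors $(\sigma_1,\ldots,\sigma_d)$, identified with the monic polynomials $Q(z)=z^d+\sigma_1z^{d-1}+\cdots+\sigma_d$. Let $H_d\subset\mathcal{V}_d$ be the (open) set of hyperbolic polynomials, i.e. those with all roots real and distinct. The root mapping $RM_d:H_d\to\mathcal{P}^x_d$ sends $Q$ to its ordered tuple of roots $x_1<\cdots<x_d$; the Vieta mapping $VM_d:\mathcal{P}^x_d\to H_d$ is $VM_d(x)=(\sigma_1(x),\ldots,\sigma_d(x))$;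 they are mutually inverse diffeomorphisms. For $q\ge d$, $L_q(\mu)\subset\mathcal{V}_d$ is the affine subspace (possibly empty) of all $(\sigma_1,\ldots,\sigma_d)\in\mathbb{R}^d$ satisfying the $q-d+1$ linear equations $\sum_{i=0}^d\mu_{l-i}\sigma_i=0$, $l=d,\ldots,q$ (with $\sigma_0=1$), and $L^h_q(\mu)=L_q(\mu)\cap H_d$. *)

(* Defs.v *)
From HB Require Import structures.
From mathcomp Require Import all_boot all_order all_algebra.
From mathcomp Require Import all_classical all_reals all_analysis.

Set Implicit Arguments.
Unset Strict Implicit.
Unset Printing Implicit Defensive.

Import Order.TTheory GRing.Theory Num.Theory.
Import numFieldNormedType.Exports.

Local Open Scope classical_set_scope.
Local Open Scope ring_scope.

Section Smoothness.
Variable R : realType.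
Implicit Types V W : normedModType R.

(* ['D_v f x] is junk where the derivative does not exist; the clause
   [differentiable f x] is what makes the recursion meaningful on [U]. *)
Fixpoint Ck_on (k : nat) V W (U : set V) (f : V -> W) : Prop :=
  match k with
  | 0 => forall x, U x -> {for x, continuous f}
  | k'.+1 => (forall x, U x -> differentiable f x) /\
             (forall v : V, Ck_on k' U (fun x => 'D_v f x))
  end.

(* A map on an arbitrary subset [A] is smooth when near each point of [A] it
   extends to a smooth map on an open set of the ambient space; for open [A]
   this is ordinary C^oo smoothness on [A]. *)
Definition smooth_on V W (A : set V) (f : V -> W) : Prop :=
  forall p, A p -> exists (U : set V) (F : V -> W),
    [/\ open U, U p, (forall k, Ck_on k U F)
      & forall x, A x -> U x -> F x = f x].

Definition inverse_diffeos V W (A : set V) (B : set W)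
    (f : V -> W) (g : W -> V) : Prop :=
  [/\ set_fun A B f, set_fun B A g,
      (forall x, A x -> g (f x) = x) & (forall y, B y -> f (g y) = y)] /\
  (smooth_on A f /\ smooth_on B g).

Definition is_diffeo V W (A : set V) (B : set W) (f : V -> W) : Prop :=
  exists g : W -> V, inverse_diffeos A B f g.

(* Embedded submanifold without boundary, of dimension [m] at every point:
   each point has a relatively open neighbourhood diffeomorphic to an open
   subset of R^m. *)
Definition smooth_submanifold V (m : nat) (S : set V) : Prop :=
  forall p, S p -> exists (U : set V) (O : set 'rV[R]_m) (f : V -> 'rV[R]_m),
    [/\ open U, U p, open O & is_diffeo (S `&` U) O f].

End Smoothness.

Section Prony.
Variables (R : realType) (d : nat).

Definition nodes : set 'rV[R]_d :=
  [set x | forall i j : 'I_d, (i < j)%N -> x 0 i < x 0 j].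

(* Points of the parameter space are pairs (a, x): amplitudes, then nodes. *)
Definition prony_params : set ('rV[R]_d * 'rV[R]_d) :=
  [set ax | nodes ax.2].

Definition prony_variety (q : nat) (mu : (2 * d).-tuple R) :
    set ('rV[R]_d * 'rV[R]_d) :=
  [set ax | prony_params ax /\
     forall k, (k <= q)%N -> \sum_(j < d) ax.1 0 j * ax.2 0 j ^+ k = mu`_k].

Definition proj_nodes (ax : 'rV[R]_d * 'rV[R]_d) : 'rV[R]_d := ax.2.

Definition prony_nodes (q : nat) (mu : (2 * d).-tuple R) : set 'rV[R]_d :=
  proj_nodes @` prony_variety q mu.

(* Sum over k-element index sets, i.e. over i_1 < ... < i_k; equals 1 for
   k = 0. *)
Definition sigma (k : nat) (x : 'rV[R]_d) : R :=
  (-1) ^+ k * \sum_(I : {set 'I_d} | #|I| == k) \prod_(i in I) x 0 i.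

(* [s] stores sigma_1, ..., sigma_d at the indices 0, ..., d - 1, and
   sigma_0 = 1 is implicit. *)
Definition vcoef (s : 'rV[R]_d) (i : 'I_d.+1) : R :=
  oapp (s 0) 1 (unlift ord0 i).

Definition vpoly (s : 'rV[R]_d) : {poly R} :=
  \sum_(i < d.+1) vcoef s i *: 'X^(d - i).

Definition hyperbolic : set 'rV[R]_d :=
  [set s | exists2 r : seq R, uniq r & vpoly s = \prod_(z <- r) ('X - z%:P)].

Definition vieta_map (x : 'rV[R]_d) : 'rV[R]_d := \row_(i < d) sigma i.+1 x.

(* For hyperbolic [s] exactly one ordered tuple qualifies; elsewhere the value
   is the junk 0. *)
Definition root_map (s : 'rV[R]_d) : 'rV[R]_d :=
  xget 0 [set x | nodes x /\ forall z, root (vpoly s) z <-> exists i, x 0 i = z].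

Definition affine_L (q : nat) (mu : (2 * d).-tuple R) : set 'rV[R]_d :=
  [set s | forall l, (d <= l <= q)%N ->
     \sum_(i < d.+1) mu`_(l - i) * vcoef s i = 0].

Definition hyperbolic_L (q : nat) (mu : (2 * d).-tuple R) : set 'rV[R]_d :=
  affine_L q mu `&` hyperbolic.

End Prony.

(* Main.v *)
Require Import Defs.
From HB Require Import structures.
From mathcomp Require Import all_boot all_order all_algebra.
From mathcomp Require Import ring lra zify.
From mathcomp Require Import polyrcf.
From mathcomp Require Import all_classical all_reals all_analysis.
Set Implicit Arguments.
Unset Strict Implicit.
Unset Printing Implicit Defensive.
Import Order.TTheory GRing.Theory Num.Theory.
Import numFieldNormedType.Exports.
Local Open Scope classical_set_scope.
Local Open Scope ring_scope.

(** In the coordinates sigma the equations of the nodes are linear, so the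
    variety is, up to diffeomorphism, an open piece of an affine space.

    If the moments of [a] at the nodes [x] are [mu], then multiplying
    prod_j (z - x_j) = sum_i sigma_i z^(d - i) by z^(l - d) and summing its
    values, all zero, at the nodes with weights [a] gives the linear recurrence
    sum_i mu_(l - i) sigma_i = 0 for d <= l <= q ([prony_recurrence]).
    Conversely the first [d] moments determine [a] by a Vandermonde system
    ([amplitudesP]), and the recurrence then propagates the moment equations
    from k < d to k <= q ([prony_varietyP]). Hence the variety is the graph of
    the map [amplitudes], which is rational in [x] with non-vanishing
    denominator on distinct nodes; this makes the projection to the nodes a
    diffeomorphism.

    The analytic content is that the root map is smooth on the open set of
    hyperbolic polynomials. By the intermediate value theorem, a polynomial
    with coefficients close to those of prod_j (z - x_j) has exactly one root
    near each x_j ([near_vieta]); so hyperbolicity is an open condition and the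
    root map is continuous. Evaluating the polynomial of [s0] at the i-th root
    of [s] yields the secant identity
      (x_i(s) - x_i(s0)) * prod_(j != i) (x_i(s) - x_j(s0))
        = - sum_j (s_j - s0_j) x_i(s)^(d - j)
    (j counted from 1, [root_map_secant]), which with continuity gives
    differentiability, the partial derivatives being rational functions of the
    roots ([root_comp_diff]). Therefore, if the root map is C^k, its
    derivatives are C^k too, and it is C^(k+1) ([Ck_on_root_comp]).

    The affine space of solutions has dimension m = d - rank, and the rank is
    at most the number q - d + 1 of equations, so m >= 2d - q - 1
    ([affine_L_chart]). A basis of its direction gives one chart for the whole
    variety ([prony_smooth_submanifold]). *)

(** * Differentiability and C^k maps *)

Section Smooth.
Context {R : realType}.
Implicit Types V W : normedModType R.

(** A map vanishing at [x] to order o(y - x) has zero differential at [x]. *)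
Lemma is_diff_flat V W (f : V -> W) (x : V) :
  f x = 0 ->
  (forall e, 0 < e -> \forall y \near x, `|f y| <= e * `|y - x|) ->
  is_diff x f 0.
Proof.
move=> fx0 fo.
have H : continuous (0 : V -> W) /\ f \o shift x = cst (f x) + \0 +o_ 0 id.
  split; first exact: cst_continuous.
  apply/eqaddoP => e e0 /=.
  have := fo e e0; rewrite (near_shift 0) /=.
  apply: filterS => y /=; rewrite !subr0 !fctE fx0 /= addr0 subr0.
  by rewrite addrK.
have d0 : 'd f x = 0 :> (V -> W) by apply/diff_unique; case: H.
by apply: DiffDef => //; apply/diff_locallyP; rewrite d0.
Qed.

Lemma near_eq_differentiable V W (f g : V -> W) (x : V) :
  (\forall y \near x, f y = g y) -> differentiable f x -> differentiable g x.
Proof.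
move=> fg df.
have fx := nbhs_singleton fg.
have -> : g = f + (g - f) by rewrite addrC subrK.
apply: differentiableD => //.
have F : is_diff x (g - f) 0; last exact: ex_diff.
apply: is_diff_flat; first by rewrite !fctE fx subrr.
move=> e e0; near=> y.
rewrite !fctE (_ : f y = g y); last by near: y.
by rewrite subrr normr0 mulr_ge0 // ltW.
Unshelve. all: by end_near. Qed.

(** Product rule at a zero of the differentiable factor: the other factor need
    only be continuous there. *)
Lemma differentiable_cont0M V (phi h : V -> R) (x v : V) :
  {for x, continuous phi} -> differentiable h x -> h x = 0 ->
  differentiable (fun y => phi y * h y) x /\
  'D_v (fun y => phi y * h y) x = phi x * 'D_v h x.
Proof.
move=> cphi dh h0.
have E : (fun y => phi y * h y) =
    (phi x *: h) + (fun y => (phi y - phi x) * h y).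
  by apply/funext => y; rewrite !fctE mulrBl addrC subrK.
have F : is_diff x (fun y => (phi y - phi x) * h y) 0.
  apply: is_diff_flat; first by rewrite h0 mulr0.
  have [k k0 hk] : exists2 k, 0 < k & \forall y \near x, `|h y| <= k * `|y - x|.
    have [k k0 hk] := linear_lipschitz (diff_continuous dh).
    exists (k + 1); first by rewrite addr_gt0.
    have /diff_locally/eqaddoP/(_ 1 ltr01) := dh.
    rewrite [X in _ -> X](near_shift 0) /= !subr0.
    apply: filterS => y /=; rewrite !fctE h0 add0r mul1r addrK => hy.
    rewrite mulrDl mul1r -(subrK ('d h x y) (h _)) addrC.
    by apply: le_trans (ler_normD _ _) _; apply: lerD.
  move=> e e0; near=> y.
  rewrite normrM.
  have -> : e * `|y - x| = (e / k) * (k * `|y - x|).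
    by rewrite mulrA divfK ?gt_eqF.
  apply: ler_pM => //; last by near: y.
  rewrite distrC; near: y.
  by apply: cvgr_dist_le cphi _ _; rewrite divr_gt0.
have dz : differentiable (phi x *: h) x by exact: differentiableZ.
have dF : differentiable (fun y => (phi y - phi x) * h y) x by exact: ex_diff.
rewrite E; split; first exact: differentiableD.
rewrite deriveD; [|exact: diff_derivable..].
by rewrite deriveZ ?(deriveE _ dF) ?diff_val ?addr0 //; exact: diff_derivable.
Unshelve. all: by end_near. Qed.

Lemma Ck_on_ext k V W (U : set V) (f g : V -> W) :
  open U -> (forall x, U x -> f x = g x) -> Ck_on k U f -> Ck_on k U g.
Proof.
move=> oU; elim: k f g => [|k IH] f g fg /=.
  move=> cf x Ux; have nU : nbhs x U by exact: open_nbhs_nbhs.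
  rewrite /prop_for /continuous_at -(fg _ Ux); apply: cvg_trans (cf _ Ux).
  by apply: near_eq_cvg; near=> y; apply: fg; near: y.
move=> [df Df]; split=> [x Ux|v].
  apply: (near_eq_differentiable (f := f)); last exact: df.
  have nU : nbhs x U by exact: open_nbhs_nbhs.
  by near=> y; apply: fg; near: y.
apply: IH (Df v) => x Ux; apply: near_eq_derive.
have nU : nbhs x U by exact: open_nbhs_nbhs.
by near=> y; apply: fg; near: y.
Unshelve. all: by end_near. Qed.

Lemma Ck_onS k V W (U : set V) (f : V -> W) : Ck_on k.+1 U f -> Ck_on k U f.
Proof.
elim: k f => [|k IH] f [df Df].
  by move=> x Ux; apply: differentiable_continuous; exact: df.
by split=> // v; apply: IH; exact: Df.
Qed.

Lemma Ck_on_sub k V W (U U' : set V) (f : V -> W) :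
  U' `<=` U -> Ck_on k U f -> Ck_on k U' f.
Proof.
move=> sU; elim: k f => [|k IH] f /=; first by move=> cf x /sU; exact: cf.
by move=> [df Df]; split=> [x /sU|v]; [exact: df|apply: IH; exact: Df].
Qed.

Lemma Ck_on_cst k V W (U : set V) (c : W) : Ck_on k U (fun _ => c).
Proof.
elim: k c => [|k IH] c /=; first by move=> x _; exact: cst_continuous.
split=> [x _|v]; first exact: differentiable_cst.
rewrite (_ : (fun x => 'D_v (fun=> c) x) = fun=> 0) //.
by apply/funext => x; exact: derive_cst.
Qed.

Lemma Ck_on_linear_comp k V W W' (U : set V) (L : W -> W')
    (f : V -> W) : open U -> linear L -> continuous L ->
  Ck_on k U f -> Ck_on k U (fun x => L (f x)).
Proof.
move=> oU linL cL.
pose Ll : {linear W -> W'} := HB.pack L (GRing.isLinear.Build _ _ _ _ L linL).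
elim: k f => [|k IH] f /=.
  by move=> cf x Ux; apply: continuous_comp; [exact: cf|exact: cL].
move=> [df Df].
have dL y : differentiable L y by exact: (linear_differentiable (f := Ll)).
split=> [x Ux|v].
  by apply: (differentiable_comp (g := L)) => //; exact: df.
apply: (Ck_on_ext oU _ (IH _ (Df v))) => x Ux /=.
have dfx := df x Ux.
rewrite [LHS]/= deriveE // [RHS]deriveE; last first.
  exact: (differentiable_comp (g := L)).
rewrite (diff_comp (g := L)) //=.
by rewrite (diff_lin (f := Ll)).
Qed.

Lemma Ck_on_id k V (U : set V) : Ck_on k U (fun x : V => x).
Proof.
case: k => [|k] /=; first by move=> x _; exact: cvg_id.
split=> [x _|v]; first exact: (@ex_diff _ _ _ _ _ _ _ (is_diff_id x)).
rewrite (_ : (fun x : V => 'D_v (fun y => y) x) = fun=> v).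
  exact: Ck_on_cst.
by apply/funext => x; exact: derive_id.
Qed.

Lemma Ck_on_linear k V W (U : set V) (L : V -> W) :
  open U -> linear L -> continuous L -> Ck_on k U L.
Proof.
move=> oU linL cL.
exact: (Ck_on_linear_comp oU linL cL (@Ck_on_id k V U)).
Qed.

Lemma Ck_onD k V W (U : set V) (f g : V -> W) : open U ->
  Ck_on k U f -> Ck_on k U g -> Ck_on k U (fun x => f x + g x).
Proof.
move=> oU; elim: k f g => [|k IH] f g /=.
  by move=> cf cg x Ux; apply: continuousD; [exact: cf|exact: cg].
move=> [df Df] [dg Dg]; split=> [x Ux|v].
  by apply: differentiableD; [exact: df|exact: dg].
apply: (Ck_on_ext oU _ (IH _ _ (Df v) (Dg v))) => x Ux /=.
by rewrite deriveD //; apply: diff_derivable; [exact: df|exact: dg].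
Qed.

Lemma Ck_onM k V (U : set V) (f g : V -> R) : open U ->
  Ck_on k U f -> Ck_on k U g -> Ck_on k U (fun x => f x * g x).
Proof.
move=> oU; elim: k f g => [|k IH] f g.
  by move=> cf cg x Ux; apply: continuousM; [exact: cf|exact: cg].
move=> Cf Cg; have [cf cg] := (Ck_onS Cf, Ck_onS Cg).
case: Cf Cg => [df Df] [dg Dg]; split=> [x Ux|v].
  by apply: differentiableM; [exact: df|exact: dg].
apply: (Ck_on_ext oU _
  (Ck_onD oU (IH _ _ cf (Dg v)) (IH _ _ cg (Df v)))) => x Ux /=.
by rewrite deriveM //; apply: diff_derivable; [exact: df|exact: dg].
Qed.

Lemma Ck_onV k V (U : set V) (f : V -> R) : open U ->
  (forall x, U x -> f x != 0) ->
  Ck_on k U f -> Ck_on k U (fun x => (f x)^-1).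
Proof.
move=> oU f0; elim: k f f0 => [|k IH] f f0.
  by move=> cf x Ux; apply: continuousV; [exact: f0|exact: cf].
move=> Cf; have cf := Ck_onS Cf; case: Cf => [df Df].
split=> [x Ux|v]; first by apply: differentiableV; [exact: df|exact: f0].
have cV := IH _ f0 cf.
apply: (Ck_on_ext oU _ (Ck_onM oU (Ck_on_cst k U (-1 : R))
  (Ck_onM oU (Ck_onM oU cV cV) (Df v)))) => x Ux /=.
rewrite deriveV; [|exact: f0|by apply: diff_derivable; exact: df].
by rewrite mulN1r scaleNr -exprVn expr2.
Qed.

Lemma Ck_on_sum k V W (U : set V) (I : finType) (P : pred I)
    (f : I -> V -> W) : open U -> (forall i, P i -> Ck_on k U (f i)) ->
  Ck_on k U (fun x => \sum_(i | P i) f i x).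
Proof.
move=> oU Cf; rewrite /index_enum; elim: (Finite.enum I) => [|i s IH].
  rewrite (_ : (fun x => _) = fun=> 0); first exact: Ck_on_cst.
  by apply/funext => x; rewrite big_nil.
have [Pi|/negbTE nPi] := boolP (P i); last first.
  by apply: Ck_on_ext IH => // x _; rewrite big_cons nPi.
apply: (Ck_on_ext (f := fun x => f i x + \sum_(j <- s | P j) f j x)) => //.
  by move=> x _; rewrite big_cons Pi.
by apply: Ck_onD => //; exact: Cf.
Qed.

Lemma Ck_on_prod k V (U : set V) (I : finType) (P : pred I)
    (f : I -> V -> R) : open U -> (forall i, P i -> Ck_on k U (f i)) ->
  Ck_on k U (fun x => \prod_(i | P i) f i x).
Proof.
move=> oU Cf; rewrite /index_enum; elim: (Finite.enum I) => [|i s IH].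
  rewrite (_ : (fun x => _) = fun=> 1); first exact: Ck_on_cst.
  by apply/funext => x; rewrite big_nil.
have [Pi|/negbTE nPi] := boolP (P i); last first.
  by apply: Ck_on_ext IH => // x _; rewrite big_cons nPi.
apply: (Ck_on_ext (f := fun x => f i x * \prod_(j <- s | P j) f j x)) => //.
  by move=> x _; rewrite big_cons Pi.
by apply: Ck_onM => //; exact: Cf.
Qed.

Lemma Ck_on_exp k V (U : set V) (f : V -> R) n : open U ->
  Ck_on k U f -> Ck_on k U (fun x => f x ^+ n).
Proof.
move=> oU Cf; elim: n => [|n IH]; first exact: Ck_on_cst.
apply: (Ck_on_ext (f := fun x => f x * f x ^+ n)) => //; last exact: Ck_onM.
by move=> x _; rewrite exprS.
Qed.

Lemma Ck_on_row k V (U : set V) n (f : V -> 'rV[R]_n) : open U ->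
  (forall i, Ck_on k U (fun x => f x 0 i)) -> Ck_on k U f.
Proof.
move=> oU Cf.
apply: (Ck_on_ext (f := fun x => \sum_i f x 0 i *: delta_mx 0 i)) => //.
  by move=> x _; rewrite [RHS]row_sum_delta.
apply: Ck_on_sum => // i _.
apply: (Ck_on_linear_comp (L := fun c : R => c *: _) oU _ _ (Cf i)).
  by move=> a x y; rewrite scalerDl scalerA.
exact: scalel_continuous.
Qed.

Lemma Ck_on_coord k V (U : set V) m n (f : V -> 'M[R]_(m, n)) i j : open U ->
  Ck_on k U f -> Ck_on k U (fun x => f x i j).
Proof.
move=> oU Cf.
apply: (Ck_on_linear_comp (L := fun M : 'M[R]_(m, n) => M i j) oU _ _ Cf).
  by move=> a x y; rewrite !mxE.
exact: coord_continuous.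
Qed.

Lemma Ck_on_pair k V W W' (U : set V) (f : V -> W) (g : V -> W') : open U ->
  Ck_on k U f -> Ck_on k U g -> Ck_on k U (fun x => (f x, g x)).
Proof.
move=> oU; elim: k f g => [|k IH] f g /=.
  by move=> cf cg x Ux; apply: cvg_pair; [exact: cf|exact: cg].
move=> [df Df] [dg Dg]; split=> [x Ux|v].
  by apply: differentiable_pair; [exact: df|exact: dg].
apply: (Ck_on_ext oU _ (IH _ _ (Df v) (Dg v))) => x Ux /=.
have dfx := df x Ux; have dgx := dg x Ux.
by rewrite [RHS]deriveE ?diff_pair //= ?deriveE //; exact: differentiable_pair.
Qed.

Lemma Ck_on_snd k V W (U : set (V * W)) : open U -> Ck_on k U (@snd V W).
Proof.
move=> oU; apply: Ck_on_linear => //.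
by move=> p; exact: cvg_snd.
Qed.

(** The form in which smoothness on an arbitrary set is established below: one
    smooth extension to one open set containing it. *)
Lemma smooth_on_open V W (A U : set V) (f F : V -> W) :
  open U -> A `<=` U -> (forall k, Ck_on k U F) ->
  (forall x, A x -> F x = f x) -> smooth_on A f.
Proof.
move=> oU AU CF Ff p Ap; exists U, F.
by split=> // [|x Ax _]; [exact: AU|exact: Ff].
Qed.

End Smooth.

(** * Vieta coefficients and the root map *)

Section Vieta.
Context {R : realType} {d : nat}.
Implicit Types x s : 'rV[R]_d.

Lemma sigma0 x : sigma 0 x = 1.
Proof.
rewrite /sigma expr0 mul1r (big_pred1 finset.set0) ?big_set0 // => I /=.
by rewrite finset.cards_eq0.
Qed.

Lemma vcoef_vieta x i : vcoef (vieta_map x) i = sigma i x.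
Proof.
rewrite /vcoef; case: unliftP => [j|] -> /=; first by rewrite mxE.
by rewrite sigma0.
Qed.

Lemma vpoly_vieta x :
  vpoly (vieta_map x) = \prod_(z <- [seq x 0 i | i <- enum 'I_d]) ('X - z%:P).
Proof.
rewrite big_map big_enum /=; under eq_bigr do rewrite addrC.
rewrite bigA_distr.
(* Group the index sets I of the expanded product by cardinality. *)
rewrite (partition_big (fun I : {set 'I_d} => inord #|I| : 'I_d.+1) predT) //=.
apply: eq_bigr => k _; rewrite vcoef_vieta /sigma -mul_polyC.
rewrite rmorphM /= rmorph_sum /= mulr_sumr mulr_suml.
have E (I : {set 'I_d}) : (inord #|I| == k) = (#|I| == k).
  by rewrite -val_eqE /= inordK // ltnS -[X in (_ <= X)%N](card_ord d) max_card.
apply: eq_big => [I|I /eqP cI]; first by rewrite E.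
rewrite [RHS](bigID (mem I)) /=.
congr (_ * _).
  rewrite (eq_bigr (fun i => (-1)%:P * (x 0 i)%:P)); last first.
    by move=> i ->; rewrite rmorphN mulNr mul1r.
  by rewrite big_split /= prodr_const cI rmorph_prod rmorphXn.
rewrite (eq_bigr (fun=> 'X)) => [|i /negbTE -> //].
rewrite prodr_const; congr ('X ^+ _).
apply: (@addnI #|I|); rewrite (cardC (mem I)) card_ord cI.
by rewrite subnKC // -ltnS.
Qed.

Lemma coef_vpoly s (i : 'I_d.+1) : (vpoly s)`_(d - i) = vcoef s i.
Proof.
rewrite /vpoly coef_sum (bigD1 i) //= big1 ?addr0.
  by rewrite coefZ coefXn eqxx mulr1.
move=> j ji; rewrite coefZ coefXn.
case: eqP => [e|_]; last by rewrite mulr0.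
case/eqP: ji; apply: val_inj => /=.
by have := ltn_ord j; have := ltn_ord i; lia.
Qed.

Lemma size_vpoly s : size (vpoly s) = d.+1.
Proof.
apply/eqP; rewrite eqn_leq; apply/andP; split.
  apply/leq_sizeP => j dj; rewrite /vpoly coef_sum big1 // => i _.
  by rewrite coefZ coefXn gtn_eqF ?mulr0 //; have := ltn_ord i; lia.
have := coef_vpoly s ord0; rewrite subn0 /vcoef unlift_none /=.
apply: contra_eqT; rewrite -leqNgt => /leq_sizeP/(_ d (leqnn d)) ->.
by rewrite eq_sym oner_eq0.
Qed.

Lemma lead_coef_vpoly s : lead_coef (vpoly s) = 1.
Proof.
rewrite lead_coefE size_vpoly /=.
by have := coef_vpoly s ord0; rewrite subn0 /vcoef unlift_none.
Qed.

Lemma vpoly_inj : injective (@vpoly R d).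
Proof.
move=> s t st; apply/rowP => i.
have := coef_vpoly s (lift ord0 i).
by rewrite st coef_vpoly /vcoef liftK.
Qed.

Lemma nodes_inj x : nodes x -> injective (x 0).
Proof.
move=> nx i j; case: (ltngtP i j) => [/nx h e|/nx h e|/val_inj //].
  by rewrite e ltxx in h.
by rewrite e ltxx in h.
Qed.

(** Increasing tuples with the same set of entries are equal. *)
Lemma nodes_eq x y : nodes x -> nodes y ->
  (forall z, (exists i, x 0 i = z) <-> (exists i, y 0 i = z)) -> x = y.
Proof.
move=> nx ny xy.
have srt u : nodes u -> sorted <%R [seq u 0 i | i <- enum 'I_d].
  move=> nu; rewrite sorted_map.
  apply: (@sub_sorted _ (relpre val ltn)) => [i j /=|]; first exact: nu.
  by rewrite -sorted_map val_enum_ord iota_ltn_sorted.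
have e : [seq x 0 i | i <- enum 'I_d] = [seq y 0 i | i <- enum 'I_d].
  apply: lt_sorted_eq; [exact: srt..|] => z.
  apply/mapP/mapP => -[i _ zi].
    have [j jz] := (xy z).1 (ex_intro _ i (esym zi)).
    by exists j; rewrite ?mem_enum.
  have [j jz] := (xy z).2 (ex_intro _ i (esym zi)).
  by exists j; rewrite ?mem_enum.
apply/rowP => i; move/eq_in_map : e; apply; exact: mem_enum.
Qed.

Lemma root_vieta x z : root (vpoly (vieta_map x)) z <-> exists i, x 0 i = z.
Proof.
rewrite vpoly_vieta root_prod_XsubC.
split=> [/mapP[i _ ->]|[i <-]]; first by exists i.
by apply: map_f; rewrite mem_enum.
Qed.

Lemma vieta_mapK x : nodes x -> root_map (vieta_map x) = x.
Proof.
move=> nx; rewrite /root_map; case: xgetP => [y -> [ny yr]|/(_ x)].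
  apply: nodes_eq => // z; rewrite -yr; exact: root_vieta.
by case; split=> // z; exact: root_vieta.
Qed.

Lemma hyperbolic_vieta x : nodes x -> hyperbolic (vieta_map x).
Proof.
move=> nx; exists [seq x 0 i | i <- enum 'I_d].
  by rewrite map_inj_uniq ?enum_uniq //; exact: nodes_inj.
exact: vpoly_vieta.
Qed.

Lemma hyperbolicP s : hyperbolic s -> exists2 x, nodes x & s = vieta_map x.
Proof.
move=> [r ur sr].
have szr : size (sort <=%R r) = d.
  by apply/eqP; rewrite size_sort -eqSS -(size_vpoly s) sr size_prod_XsubC.
exists (\row_i (sort <=%R r)`_i).
  move=> i j ij; rewrite !mxE.
  have := @sorted_ltn_nth _ <%R lt_trans 0 (sort <=%R r).
  rewrite sort_lt_sorted ur => /(_ isT); apply => //; by rewrite inE szr.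
apply: vpoly_inj; rewrite vpoly_vieta sr big_map big_enum /=.
transitivity (\prod_(z <- sort <=%R r) ('X - z%:P)).
  by apply: perm_big; rewrite perm_sym perm_sort.
by rewrite (big_nth 0) szr big_mkord; apply: eq_bigr => i _; rewrite mxE.
Qed.

Lemma root_mapP s : hyperbolic s ->
  nodes (root_map s) /\ vieta_map (root_map s) = s.
Proof. by move=> /hyperbolicP [x nx ->]; rewrite vieta_mapK. Qed.

(** A monic polynomial of degree [d] vanishing at [d] distinct points is the
    product of the corresponding linear factors. *)
Lemma vpoly_of_roots s x : nodes x -> (forall i, root (vpoly s) (x 0 i)) ->
  s = vieta_map x.
Proof.
move=> nx rx; apply: vpoly_inj; rewrite vpoly_vieta.
rewrite -[RHS]scale1r -{1}(lead_coef_vpoly s); apply: all_roots_prod_XsubC.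
- by rewrite size_vpoly size_map size_enum_ord.
- by apply/allP => z /mapP[i _ ->].
- by rewrite uniq_rootsE map_inj_uniq ?enum_uniq //; exact: nodes_inj.
Qed.

Lemma horner_vpoly_vieta x z :
  (vpoly (vieta_map x)).[z] = \prod_(i < d) (z - x 0 i).
Proof.
rewrite vpoly_vieta horner_prod big_map big_enum /=.
by apply: eq_bigr => i _; rewrite hornerXsubC.
Qed.

Lemma horner_vpoly s z :
  (vpoly s).[z] = z ^+ d + \sum_(i < d) s 0 i * z ^+ (d - i.+1).
Proof.
rewrite /vpoly horner_sum big_ord_recl /=; congr (_ + _).
  by rewrite /vcoef unlift_none scale1r hornerXn subn0.
by apply: eq_bigr => i _; rewrite hornerZ hornerXn /vcoef liftK.
Qed.

End Vieta.

(** * Continuity of the roots *)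

Section Roots.
Context {R : realType} {d : nat}.
Implicit Types x s : 'rV[R]_d.

Lemma Ck_on_vpoly k (U : set 'rV[R]_d) z : open U ->
  Ck_on k U (fun s => (vpoly s).[z]).
Proof.
move=> oU.
apply: (Ck_on_ext (f := fun s : 'rV_d =>
  z ^+ d + \sum_(i < d) s 0 i * z ^+ (d - i.+1))) => //.
  by move=> s _; rewrite horner_vpoly.
apply: Ck_onD => //; first exact: Ck_on_cst.
apply: Ck_on_sum => // i _; apply: Ck_onM => //; last exact: Ck_on_cst.
by apply: Ck_on_coord => //; exact: Ck_on_id.
Qed.

(** Continuity of simple real roots: the signs of the polynomial at both ends of
    a small interval around each root persist under perturbation, so each
    interval keeps a root, and these [d] roots are all there are. *)
Lemma near_vieta x0 e : nodes x0 -> 0 < e ->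
  \forall s \near vieta_map x0, exists x, [/\ nodes x, vieta_map x = s
    & forall i, `|x 0 i - x0 0 i| < e].
Proof.
move=> nx0 e0.
(* The intervals of radius e1 around the roots are pairwise disjoint. *)
have [e1 [e10 e1e gap]] : exists e1, [/\ 0 < e1, e1 <= e &
    forall i j : 'I_d, (i < j)%N -> e1 + e1 < x0 0 j - x0 0 i].
  have gap : \forall u \near (0 : R)^'+, forall ij : 'I_d * 'I_d,
      (ij.1 < ij.2)%N -> u + u < x0 0 ij.2 - x0 0 ij.1.
    apply: filter_forall => -[i j] /=.
    have [ij|ij] := boolP (i < j)%N; last exact: nearW.
    near=> u; move=> _; rewrite -mulr2n -mulr_natr -ltr_pdivlMr ?ltr0n //.
    by near: u; apply: nbhs_right_lt; rewrite divr_gt0 // subr_gt0; exact: nx0.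
  near (0 : R)^'+ => e1; exists e1; split.
  - by near: e1; exact: nbhs_right_gt.
  - by near: e1; exact: nbhs_right_le.
  - have H : forall ij : 'I_d * 'I_d, (ij.1 < ij.2)%N ->
        e1 + e1 < x0 0 ij.2 - x0 0 ij.1 by near: e1; exact: gap.
    by move=> i j; exact: (H (i, j)).
(* The factor of index i equals - e1 ^+ 2; by the choice of e1 the others,
   (x_i - x_j) ^+ 2 - e1 ^+ 2, are positive. *)
have sgn i : (vpoly (vieta_map x0)).[x0 0 i - e1] *
             (vpoly (vieta_map x0)).[x0 0 i + e1] < 0.
  rewrite !horner_vpoly_vieta -big_split /= (bigD1 i) //=.
  rewrite nmulr_rlt0; last by nra.
  apply: prodr_gt0 => j ji; have := gap i j; have := gap j i.
  by case: (ltngtP i j) => [_ _ /(_ isT)|_ /(_ isT) + _|/val_inj ij];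
    [nra|nra|rewrite ij eqxx in ji].
have cvp z : {for vieta_map x0, continuous (fun s => (vpoly s).[z])}.
  exact: (@Ck_on_vpoly 0 setT z openT).
have nsgn : \forall s \near vieta_map x0, forall i,
    (vpoly s).[x0 0 i - e1] * (vpoly s).[x0 0 i + e1] < 0.
  apply: (@filter_forall _ _ (fun i s => (vpoly s).[x0 0 i - e1] *
    (vpoly s).[x0 0 i + e1] < 0) (nbhs (vieta_map x0)) _) => i.
  exact: (cvgr_lt _ (cvgM (cvp (x0 0 i - e1)) (cvp (x0 0 i + e1))) _ (sgn i)).
apply: filterS nsgn => s ss.
have rt i : exists y, [/\ x0 0 i - e1 < y, y < x0 0 i + e1 & root (vpoly s) y].
  have [|y] := poly_ivtoo _ (ss i); first by lra.
  by rewrite in_itv /= => /andP[]; exists y.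
have [y yP] := choice rt.
have ny : nodes (\row_i y i).
  move=> i j /gap ij; rewrite !mxE.
  by have [_ yi _] := yP i; have [yj _ _] := yP j; lra.
exists (\row_i y i); split=> // [|i].
  by apply/esym/vpoly_of_roots => // i; rewrite mxE; have [] := yP i.
by have [y1 y2 _] := yP i; rewrite mxE ltr_norml; apply/andP; split; lra.
Unshelve. all: by end_near. Qed.

Lemma open_hyperbolic : open (@hyperbolic R d).
Proof.
rewrite openE => s /hyperbolicP[x nx ->].
have H : \forall t \near vieta_map x, hyperbolic t; last exact: H.
near=> t.
have [y [ny <- _]] : exists y, [/\ nodes y, vieta_map y = t
    & forall i, `|y 0 i - x 0 i| < 1] by near: t; exact: near_vieta.
exact: hyperbolic_vieta.
Unshelve. all: by end_near. Qed.

Lemma root_map_continuous s i : hyperbolic s ->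
  {for s, continuous (fun t => @root_map R d t 0 i)}.
Proof.
move=> /hyperbolicP[x nx ->].
apply/(@cvgrPdist_lt R R _ (nbhs (vieta_map x)) _) => e e0.
near=> t.
have [y [ny <- yx]] : exists y, [/\ nodes y, vieta_map y = t
    & forall i, `|y 0 i - x 0 i| < e] by near: t; exact: near_vieta.
by rewrite !vieta_mapK // distrC.
Unshelve. all: by end_near. Qed.

(** Both sides equal the value at the root x_i(s) of the polynomial with
    coefficients [s0]. *)
Lemma root_map_secant s s0 i : hyperbolic s -> hyperbolic s0 ->
  (root_map s 0 i - root_map s0 0 i) *
    \prod_(j < d | j != i) (root_map s 0 i - root_map s0 0 j) =
  - \sum_(j < d) (s 0 j - s0 0 j) * root_map s 0 i ^+ (d - j.+1).
Proof.
move=> /root_mapP[ns es] /root_mapP[ns0 es0].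
set y := root_map s 0 i.
have : (vpoly s).[y] = 0.
  by apply/rootP; rewrite -es; apply/root_vieta; exists i.
have : (vpoly s0).[y] = (y - root_map s0 0 i) *
    \prod_(j < d | j != i) (y - root_map s0 0 j).
  by rewrite -{1}es0 horner_vpoly_vieta (bigD1 i).
move=> <-; rewrite !horner_vpoly => /eqP; rewrite addr_eq0 => /eqP ->.
under [in RHS]eq_bigr do rewrite mulrBl.
by rewrite sumrB opprB addrC.
Qed.

End Roots.

(** * Smoothness of the root map *)

Section RootSmooth.
Context {R : realType} {d : nat} {V : normedModType R}.
Variables (U : set V) (sg : V -> 'rV[R]_d).
Hypotheses (oU : open U) (hsg : forall t, U t -> hyperbolic (sg t)).

(** The i-th root along the family of polynomials [sg]. *)
Let X (i : 'I_d) (t : V) : R := root_map (sg t) 0 i.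

(** The partial derivative of the i-th root with respect to the coefficient of
    degree d - j - 1, at the polynomial [sg t]. *)
Definition root_partial (i j : 'I_d) (t : V) : R :=
  - X i t ^+ (d - j.+1) * (\prod_(l < d | l != i) (X i t - X l t))^-1.

Lemma root_gap_neq0 i t : U t -> \prod_(l < d | l != i) (X i t - X l t) != 0.
Proof.
move=> Ut; apply/prodf_neq0 => l li; rewrite subr_eq0.
have [nx _] := root_mapP (hsg Ut).
by apply: contra_neq li => /(nodes_inj nx).
Qed.

Lemma Ck_on0_root_comp i : Ck_on 0 U sg -> Ck_on 0 U (X i).
Proof.
move=> csg t Ut.
apply: (@continuous_comp _ _ _ sg (fun s => root_map s 0 i)); first exact: csg.
exact/root_map_continuous/hsg.
Qed.

(** The derivative of a root along a family of hyperbolic polynomials. By the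
    secant identity the increment of a root is a combination of the increments
    of the coefficients, with factors that are continuous because the roots are,
    so [differentiable_cont0M] applies. *)
Lemma root_comp_diff i t v : Ck_on 1 U sg -> U t ->
  differentiable (X i) t /\
  'D_v (X i) t = \sum_(j < d) root_partial i j t * 'D_v (fun u => sg u 0 j) t.
Proof.
move=> Csg Ut.
have cX l : Ck_on 0 U (X l) by apply: Ck_on0_root_comp; exact: Ck_onS.
have dsg j : differentiable (fun u => sg u 0 j) t.
  by have [+ _] := @Ck_on_coord _ 1 _ _ _ _ _ 0 j oU Csg; apply.
pose D u := \prod_(l < d | l != i) (X i u - X l t).
have cD : {for t, continuous D}.
  suff : Ck_on 0 U D by exact.
  apply: Ck_on_prod => // l _.
  by apply: Ck_onD => //; exact: Ck_on_cst.
have D0 : D t != 0 by exact: root_gap_neq0.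
pose phi (j : 'I_d) u := - X i u ^+ (d - j.+1) * (D u)^-1.
have cphi j : {for t, continuous (phi j)}.
  apply: continuousM; last exact: continuousV.
  have CXn : Ck_on 0 U (fun u => X i u ^+ (d - j.+1)) by exact: Ck_on_exp.
  by apply: continuousN; exact: CXn.
pose h (j : 'I_d) u := sg u 0 j - sg t 0 j.
have dh j : differentiable (h j) t by apply: differentiableB.
have dfh j : differentiable (fun u => phi j u * h j u) t /\
    'D_v (fun u => phi j u * h j u) t = phi j t * 'D_v (h j) t.
  by apply: differentiable_cont0M => //; rewrite /h subrr.
(* The secant identity solved for X i u, which is possible near t. *)
have E : \forall u \near t,
    (cst (X i t) + \sum_(j < d) (fun u => phi j u * h j u)) u = X i u.
  have nU : \forall u \near t, U u by exact: open_nbhs_nbhs.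
  have nD : \forall u \near t, D u != 0 by exact: (cvgr_neq0 _ cD).
  near=> u.
  have Uu : U u by near: u.
  have Du : D u != 0 by near: u.
  suff S : \sum_(j < d) phi j u * h j u = X i u - X i t.
    transitivity (X i t + \sum_(j < d) phi j u * h j u).
      by rewrite [LHS]/(_ + _) fct_sumE.
    by rewrite S addrC subrK.
  apply: (mulIf Du).
  rewrite (root_map_secant i (hsg Uu) (hsg Ut)) -sumrN mulr_suml.
  apply: eq_bigr => j _; rewrite /phi /h -/(X i u).
  by rewrite mulrAC divfK // mulrC mulrN.
have ds : differentiable (\sum_(j < d) (fun u => phi j u * h j u)) t.
  by apply: differentiable_sum => j; have [] := dfh j.
split; first by apply: near_eq_differentiable E _; exact: differentiableD.
rewrite -(near_eq_derive v E) deriveD; [|exact: diff_derivable..].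
rewrite derive_cst add0r derive_sum; last first.
  by move=> j; apply: diff_derivable; have [] := dfh j.
apply: eq_bigr => j _; have [_ ->] := dfh j; congr (_ * _).
by rewrite deriveB ?derive_cst ?subr0 //; exact: diff_derivable.
Unshelve. all: by end_near. Qed.

(** Bootstrap: the derivative of a root is rational in the roots, hence as
    regular as the roots themselves. The family [sg] covers both the identity
    and the affine parametrisations of linear sections. *)
Lemma Ck_on_root_comp k i : Ck_on k U sg -> Ck_on k U (X i).
Proof.
elim: k i => [|k IH] i Csg; first exact: Ck_on0_root_comp.
have C1 : Ck_on 1 U sg.
  by elim: (k) Csg {IH} => // m IHm /Ck_onS.
have CX l : Ck_on k U (X l) by apply: IH; exact: Ck_onS.
split=> [t Ut|v]; first by have [] := root_comp_diff i 0 C1 Ut.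
apply: (Ck_on_ext (f := fun t => \sum_(j < d)
  root_partial i j t * 'D_v (fun u => sg u 0 j) t)) => //.
  by move=> t Ut; have [_ ->] := root_comp_diff i v C1 Ut.
have CN (f : V -> R) : Ck_on k U f -> Ck_on k U (fun x => - f x).
  move=> Cf; apply: (Ck_on_ext (f := fun x => -1 * f x)) => //.
    by move=> x _; rewrite mulN1r.
  by apply: Ck_onM => //; exact: Ck_on_cst.
apply: Ck_on_sum => // j _; apply: Ck_onM => //; last first.
  by have [_] := @Ck_on_coord _ k.+1 _ _ _ _ _ 0 j oU Csg; exact.
apply: Ck_onM => //; first by apply: CN; exact: Ck_on_exp.
apply: Ck_onV => // [t|]; first exact: root_gap_neq0.
apply: Ck_on_prod => // l _; apply: Ck_onD => //; exact: CN.
Qed.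

End RootSmooth.

(** * Matrices and Vieta coefficients depending smoothly on a parameter *)

Section MatrixSmooth.
Context {R : realType} {V : normedModType R}.
Variables (k : nat) (U : set V).
Hypothesis oU : open U.

Lemma Ck_on_mulmxr n p (f : V -> 'rV[R]_n) (B : 'M[R]_(n, p)) :
  Ck_on k U f -> Ck_on k U (fun t => f t *m B).
Proof.
move=> Cf; apply: Ck_on_row => // j.
apply: (Ck_on_ext (f := fun t => \sum_l f t 0 l * B l j)) => //.
  by move=> t _; rewrite mxE.
apply: Ck_on_sum => // l _; apply: Ck_onM => //; last exact: Ck_on_cst.
exact: Ck_on_coord.
Qed.

Lemma Ck_on_det n (M : V -> 'M[R]_n) :
  (forall i j, Ck_on k U (fun t => M t i j)) -> Ck_on k U (fun t => \det (M t)).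
Proof.
move=> CM; apply: Ck_on_sum => // s _; apply: Ck_onM => //.
  exact: Ck_on_cst.
exact: Ck_on_prod.
Qed.

Lemma Ck_on_adj n (M : V -> 'M[R]_n) i j :
  (forall i j, Ck_on k U (fun t => M t i j)) ->
  Ck_on k U (fun t => (\adj (M t)) i j).
Proof.
move=> CM; apply: (Ck_on_ext (f := fun t => cofactor (M t) j i)) => //.
  by move=> t _; rewrite mxE.
apply: Ck_onM => //; first exact: Ck_on_cst.
apply: Ck_on_det => i' j'.
apply: (Ck_on_ext (f := fun t => M t (lift j i') (lift i j'))) => //.
by move=> t _; rewrite !mxE.
Qed.

Lemma Ck_on_vieta d (f : V -> 'rV[R]_d) :
  Ck_on k U f -> Ck_on k U (fun t => vieta_map (f t)).
Proof.
move=> Cf; apply: Ck_on_row => // i.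
apply: (Ck_on_ext (f := fun t => sigma i.+1 (f t))) => //.
  by move=> t _; rewrite mxE.
apply: Ck_onM => //; first exact: Ck_on_cst.
apply: Ck_on_sum => // I _; apply: Ck_on_prod => // j _; exact: Ck_on_coord.
Qed.

End MatrixSmooth.

(** * Amplitudes and the Prony equations *)

Section Amplitudes.
Context {R : realType} {d : nat}.
Implicit Types (x a s : 'rV[R]_d) (mu : (2 * d).-tuple R).

Lemma open_nodes : open (@nodes R d).
Proof.
rewrite openE => x nx.
pose lt_at (ij : 'I_d * 'I_d) (y : 'rV[R]_d) :=
  (ij.1 < ij.2)%N -> 0 < y 0 ij.2 - y 0 ij.1.
have H : \forall y \near x, forall ij, lt_at ij y.
  apply: (@filter_forall _ _ lt_at (nbhs x) _) => -[i j]; rewrite /lt_at /=.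
  have [ij|ij] := boolP (i < j)%N; last exact: nearW.
  have c : {for x, continuous (fun y : 'rV[R]_d => y 0 j - y 0 i)}.
    by apply: continuousB; exact: coord_continuous.
  have x0 : 0 < x 0 j - x 0 i by rewrite subr_gt0; exact: nx.
  near=> y; move=> _; near: y; exact: (cvgr_gt _ c _ x0).
have H' : \forall y \near x, nodes y; last exact: H'.
near=> y; move=> i j ij; rewrite -subr_gt0.
have G : forall ij, lt_at ij y by near: y.
exact: (G (i, j)).
Unshelve. all: by end_near. Qed.

(** The matrix of powers of the nodes, with entry x_i^k in row i and column k;
    the moments of the row vector [a] are the entries of [a *m node_mx x]. *)
Definition node_mx x : 'M[R]_d := (Vandermonde d x)^T.

(** The solution [a] of the first [d] moment equations at the nodes [x], by
    Cramer's rule, so that it is visibly rational in [x]. *)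
Definition amplitudes mu x : 'rV[R]_d :=
  (\det (node_mx x))^-1 *: ((\row_(k < d) mu`_k) *m \adj (node_mx x)).

Lemma det_node_mx x : nodes x -> \det (node_mx x) != 0.
Proof.
move=> nx; rewrite det_tr det_Vandermonde.
apply/prodf_neq0 => i _; apply/prodf_neq0 => j ij.
by rewrite subr_eq0 gt_eqF //; exact: nx.
Qed.

Lemma amplitudesP mu a x : nodes x ->
  (forall k, (k < d)%N -> \sum_(j < d) a 0 j * x 0 j ^+ k = mu`_k) <->
  a = amplitudes mu x.
Proof.
move=> nx; have D0 := det_node_mx nx.
have E : (forall k, (k < d)%N -> \sum_(j < d) a 0 j * x 0 j ^+ k = mu`_k) <->
    a *m node_mx x = \row_(k < d) mu`_k.
  split=> [ak|/rowP ak k kd].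
    apply/rowP => k; rewrite !mxE -ak //.
    by apply: eq_bigr => j _; rewrite !mxE.
  have := ak (Ordinal kd); rewrite !mxE => <-.
  by apply: eq_bigr => j _; rewrite !mxE.
rewrite E /amplitudes; split=> [<-|->].
  by rewrite -mulmxA mul_mx_adj mul_mx_scalar scalerA mulVf // scale1r.
by rewrite -scalemxAl -mulmxA mul_adj_mx mul_mx_scalar scalerA mulVf // scale1r.
Qed.

Lemma Ck_on_amplitudes k (V : normedModType R) (U : set V) mu
    (f : V -> 'rV[R]_d) :
  open U -> (forall t, U t -> nodes (f t)) ->
  Ck_on k U f -> Ck_on k U (fun t => amplitudes mu (f t)).
Proof.
move=> oU nf Cf.
have CN i j : Ck_on k U (fun t => node_mx (f t) i j).
  apply: (Ck_on_ext (f := fun t => f t 0 i ^+ j)) => //.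
    by move=> t _; rewrite !mxE.
  by apply: Ck_on_exp => //; exact: Ck_on_coord.
apply: Ck_on_row => // i.
apply: (Ck_on_ext (f := fun t => (\det (node_mx (f t)))^-1 *
  \sum_(j < d) mu`_j * (\adj (node_mx (f t))) j i)) => //.
  move=> t _; rewrite [RHS]mxE; congr (_ * _); rewrite [RHS]mxE.
  by apply: eq_bigr => j _; rewrite [in RHS]mxE.
apply: Ck_onM => //.
  apply: Ck_onV => // [t Ut|]; first by apply: det_node_mx; exact: nf.
  exact: Ck_on_det.
apply: Ck_on_sum => // j _; apply: Ck_onM => //; first exact: Ck_on_cst.
exact: Ck_on_adj.
Qed.

(** The moments of any amplitudes [a] at the nodes [x] satisfy the linear
    recurrence whose characteristic polynomial has the nodes as roots. *)
Lemma prony_recurrence a x l : (d <= l)%N ->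
  \sum_(i < d.+1) (\sum_(j < d) a 0 j * x 0 j ^+ (l - i)) * sigma i x = 0.
Proof.
move=> dl; under eq_bigr do rewrite mulr_suml.
rewrite exchange_big /= big1 // => j _.
have : (vpoly (vieta_map x)).[x 0 j] = 0.
  by apply/rootP/root_vieta; exists j.
rewrite /vpoly horner_sum => e.
apply: etrans (_ : _ = a 0 j * x 0 j ^+ (l - d) * 0) (mulr0 _).
rewrite -[X in _ * X]e mulr_sumr.
apply: eq_bigr => i _; rewrite hornerZ hornerXn vcoef_vieta.
have -> : (l - i = (l - d) + (d - i))%N by have := ltn_ord i; lia.
rewrite exprD; ring.
Qed.

(** The equations of the nodes, as a system in the sigma_i(x). *)
Definition vieta_system q mu x : Prop :=
  forall l, (d <= l <= q)%N -> \sum_(i < d.+1) mu`_(l - i) * sigma i x = 0.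

(** The Prony variety is the graph of [amplitudes] over the solutions of the
    system of the nodes. *)
Lemma prony_varietyP q mu a x : (d <= q)%N ->
  prony_variety q mu (a, x) <->
  [/\ nodes x, a = amplitudes mu x & vieta_system q mu x].
Proof.
move=> dq; split=> [[/= nx ak]|[nx ea sys]].
  split=> // [|l /andP[dl lq]].
    by apply/amplitudesP => // k kd; apply: ak; lia.
  rewrite -[RHS](prony_recurrence a x dl); apply: eq_bigr => i _.
  by rewrite ak //; lia.
(* The recurrence at k expresses the k-th moment through the previous d. *)
split=> //= k; elim/ltn_ind: k => k IH kq.
have [kd|dk] := ltnP k d; first by apply: (amplitudesP mu a nx).2.
have := sys k; rewrite dk kq => /(_ isT).
rewrite -[X in _ = X](prony_recurrence a x dk).
rewrite !big_ord_recl /= sigma0 !mulr1 !subn0.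
move=> e; apply/esym; move: e; rewrite [X in _ + X = _](eq_bigr (fun i : 'I_d =>
    (\sum_(j < d) a 0 j * x 0 j ^+ (k - bump 0 i)) * sigma (bump 0 i) x)).
  exact: addIr.
move=> i _; rewrite IH //; rewrite /bump /=; have := ltn_ord i; lia.
Qed.

Lemma prony_nodesP q mu x : (d <= q)%N ->
  prony_nodes q mu x <-> nodes x /\ vieta_system q mu x.
Proof.
move=> dq; split=> [[[a y] /(prony_varietyP _ _ _ dq)[ny _ sy] <-] //|[nx sx]].
by exists (amplitudes mu x, x) => //; apply/prony_varietyP.
Qed.

Lemma affine_L_vieta q mu x :
  affine_L q mu (vieta_map x) <-> vieta_system q mu x.
Proof.
split=> H l lq; rewrite -[RHS](H l lq);
  by apply: eq_bigr => i _; rewrite vcoef_vieta.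
Qed.

(** The affine space is [s0] plus the row space of [B], whose [m] rows are a
    basis of the solutions of the homogeneous system. *)
Lemma affine_L_chart q mu s0 : (d <= q)%N -> affine_L q mu s0 ->
  exists (m : nat) (B : 'M[R]_(m, d)),
    [/\ (2 * d - q - 1 <= m)%N, row_free B
      & forall s, affine_L q mu s <-> (s - s0 <= B)%MS].
Proof.
move=> dq Ls0.
(* Column l holds the coefficients of sigma_1, ..., sigma_d in the equation of
   index d + l. *)
pose A : 'M[R]_(d, (q - d).+1) := \matrix_(i, l) mu`_(d + l - i.+1).
exists (\rank (kermx A)), (row_base (kermx A)); split.
- by rewrite mxrank_ker; have := rank_leq_col A; lia.
- exact: row_base_free.
move=> s; rewrite eq_row_base.
have E l : \sum_(i < d.+1) mu`_(l - i) * vcoef s i =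
    \sum_(i < d.+1) mu`_(l - i) * vcoef s0 i +
    \sum_(i < d) (s - s0) 0 i * mu`_(l - i.+1).
  rewrite !big_ord_recl /= /vcoef !unlift_none /= -addrA; congr (_ + _).
  rewrite -big_split /=; apply: eq_bigr => i _; rewrite !liftK /= !mxE.
  rewrite /bump /= add1n; ring.
have EA (l : 'I_(q - d).+1) : \sum_(i < d) (s - s0) 0 i * mu`_(d + l - i.+1) =
    ((s - s0) *m A) 0 l.
  by rewrite [RHS]mxE; apply: eq_bigr => i _; rewrite [A _ _]mxE.
split=> [Ls|/sub_kermxP ss l lq].
  apply/sub_kermxP/rowP => l; rewrite -EA mxE.
  have lq : (d <= d + l <= q)%N by have := ltn_ord l; lia.
  by have := E (d + l)%N; rewrite Ls // Ls0 // add0r.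
rewrite E Ls0 // add0r.
have lq' : (l - d < (q - d).+1)%N by lia.
by have := EA (Ordinal lq'); rewrite ss mxE /= subnKC //; case/andP: lq.
Qed.

End Amplitudes.

(** * Charts and diffeomorphisms *)

Section Prony.
Context {R : realType} {d : nat}.
Variables (q : nat) (mu : (2 * d).-tuple R).
Hypothesis dq : (d <= q)%N.

Lemma hyperbolic_L_root_map s : hyperbolic_L q mu s ->
  prony_nodes q mu (root_map s).
Proof.
move=> [Ls /root_mapP[nx e]]; apply/prony_nodesP => //.
by split=> //; apply/affine_L_vieta; rewrite e.
Qed.

Lemma vieta_map_hyperbolic_L x : prony_nodes q mu x ->
  hyperbolic_L q mu (vieta_map x).
Proof.
move=> /(prony_nodesP _ _ dq)[nx sx]; split; first exact/affine_L_vieta.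
exact: hyperbolic_vieta.
Qed.

(** A single global chart: the Vieta coefficients of the nodes, expressed in a
    basis of the direction of the affine space. *)
Lemma prony_smooth_submanifold (p0 : 'rV[R]_d * 'rV[R]_d) :
  prony_variety q mu p0 ->
  exists2 m : nat, (2 * d - q - 1 <= m)%N &
    smooth_submanifold m (prony_variety q mu).
Proof.
case: p0 => a0 x0 /(prony_varietyP _ _ _ dq)[nx0 _ /affine_L_vieta sx0].
set s0 := vieta_map x0 in sx0.
have [m [B [hm Bfree BL]]] := affine_L_chart dq sx0.
exists m => // p _.
pose c (t : 'rV[R]_m) : 'rV[R]_d := s0 + t *m B.
pose O : set 'rV[R]_m := c @^-1` @hyperbolic R d.
have Cc k : Ck_on k setT c.
  apply: Ck_onD; [exact: openT|exact: Ck_on_cst|].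
  by apply: Ck_on_mulmxr; [exact: openT|exact: Ck_on_id].
have oO : open O.
  apply: open_comp open_hyperbolic => t _; exact: (Cc 0).
have CX k : Ck_on k O (fun t => root_map (c t)).
  apply: Ck_on_row => // i; apply: Ck_on_root_comp => //.
  exact: Ck_on_sub (Cc k).
exists setT, O, (fun p => (vieta_map p.2 - s0) *m pinvmx B); split=> //.
  exact: openT.
exists (fun t => (amplitudes mu (root_map (c t)), root_map (c t))).
rewrite setIT.
have cf a x : prony_variety q mu (a, x) ->
    c ((vieta_map x - s0) *m pinvmx B) = vieta_map x.
  move=> /(prony_varietyP _ _ _ dq)[nx _ /affine_L_vieta/BL sx].
  by rewrite /c mulmxKpV // addrC subrK.
split; [split|split].
- move=> [a x] Sp; rewrite /O /preimage /= (cf _ _ Sp).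
  by have [nx _ _] := (prony_varietyP _ _ _ dq).1 Sp; exact: hyperbolic_vieta.
- move=> t Ot; apply/prony_varietyP => //.
  have /root_mapP[nx e] := Ot; split=> //.
  apply/affine_L_vieta; rewrite e; apply/BL.
  by rewrite /c addrC addKr submxMl.
- move=> [a x] Sp /=; rewrite (cf _ _ Sp).
  by have [nx -> _] := (prony_varietyP _ _ _ dq).1 Sp; rewrite vieta_mapK.
- move=> t Ot /=; have [_ ->] := root_mapP Ot.
  by rewrite /c addrC addKr mulmxKp.
- apply: (smooth_on_open (U := setT)) => // [|k]; first exact: openT.
  apply: Ck_on_mulmxr; first exact: openT.
  apply: Ck_onD; [exact: openT| |exact: Ck_on_cst].
  by apply: Ck_on_vieta; [exact: openT|apply: Ck_on_snd; exact: openT].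
- apply: (smooth_on_open (U := O)) => // k.
  apply: Ck_on_pair => //; apply: Ck_on_amplitudes => //.
  by move=> t /root_mapP[].
Qed.

Lemma vieta_root_inverse_diffeos :
  inverse_diffeos (prony_nodes q mu) (hyperbolic_L q mu)
    (@vieta_map R d) (@root_map R d).
Proof.
split; [split|split].
- by move=> x; exact: vieta_map_hyperbolic_L.
- by move=> s; exact: hyperbolic_L_root_map.
- by move=> x /(prony_nodesP _ _ dq)[nx _]; exact: vieta_mapK.
- by move=> s [_ /root_mapP[]].
- apply: (smooth_on_open (U := setT)) => // [|k]; first exact: openT.
  by apply: Ck_on_vieta; [exact: openT|exact: Ck_on_id].
- apply: (smooth_on_open (U := @hyperbolic R d)) => //.
  + exact: open_hyperbolic.
  + by move=> s [].
  move=> k; apply: Ck_on_row; first exact: open_hyperbolic.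
  move=> i; apply: (Ck_on_root_comp (sg := id)) => //.
    exact: open_hyperbolic.
  exact: Ck_on_id.
Qed.

Lemma proj_nodes_diffeo :
  inverse_diffeos (prony_variety q mu) (prony_nodes q mu) (@proj_nodes R d)
    (fun x => (amplitudes mu x, x)).
Proof.
split; [split|split].
- by move=> p Sp; exists p.
- by move=> x /(prony_nodesP _ _ dq)[nx sx]; apply/prony_varietyP.
- by move=> [a x] /(prony_varietyP _ _ _ dq)[_ -> _].
- by [].
- apply: (smooth_on_open (U := setT)) => // [|k]; first exact: openT.
  by apply: Ck_on_snd; exact: openT.
- apply: (smooth_on_open (U := @nodes R d)) => //; first exact: open_nodes.
    by move=> x /(prony_nodesP _ _ dq)[].
  move=> k; apply: Ck_on_pair; [exact: open_nodes| |exact: Ck_on_id].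
  by apply: Ck_on_amplitudes; [exact: open_nodes| |exact: Ck_on_id].
Qed.

Lemma proj_nodes_bij :
  set_bij (prony_variety q mu) (prony_nodes q mu) (@proj_nodes R d).
Proof.
have [[fS fN fK gK] _] := proj_nodes_diffeo.
split=> // p p' /set_mem Sp /set_mem Sp' e.
by rewrite -(fK p) // -(fK p') // e.
Qed.

End Prony.

Theorem theorem2p3 (R : realType) (d q : nat) (mu : (2 * d).-tuple R)
    (hd : (1 <= d)%N) (hq : (d <= q <= 2 * d - 1)%N) :
  [/\ prony_variety q mu = set0 \/
        (exists2 m : nat, (2 * d - q - 1 <= m)%N &
           smooth_submanifold m (prony_variety q mu)),
      prony_nodes q mu =
        [set x | nodes x /\ forall l, (d <= l <= q)%N ->
           \sum_(i < d.+1) mu`_(l - i) * sigma i x = 0] /\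
        inverse_diffeos (prony_nodes q mu) (hyperbolic_L q mu)
          (@vieta_map R d) (@root_map R d) &
      set_bij (prony_variety q mu) (prony_nodes q mu) (@proj_nodes R d) /\
        is_diffeo (prony_variety q mu) (prony_nodes q mu) (@proj_nodes R d)].
Proof.
have [dq _] := andP hq.
split.
- have [->|/set0P[p Sp]] := eqVneq (prony_variety q mu) set0; first by left.
  by right; exact: (prony_smooth_submanifold dq Sp).
- split; last exact: vieta_root_inverse_diffeos.
  by apply/seteqP; split=> x /prony_nodesP; apply.
- split; first exact: proj_nodes_bij.
  by eexists; exact: proj_nodes_diffeo.
Qed.
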